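(* Let $1\le p<N$, let $\mathbf{x}_1,\dots,\mathbf{x}_N\in\mathbb{R}^n$, let $\varepsilon>0$ and let $\phi:[0,\infty)\to\mathbb{R}$ be such that the interpolation matrix $\tilde{\mathbf{A}}=\big(\phi(\varepsilon\|\mathbf{x}_i-\mathbf{x}_j\|)\big)_{1\le i,j\le p}$ is symmetric and positive definite (hence invertible). Let $\mathbf{C}=\big(\phi(\varepsilon\|\mathbf{x}_i-\mathbf{x}_j\|)\big)_{p<i\le N,\ 1\le j\le p}$, let $\mathbf{I}$ be the $(N-p)\times(N-p)$ identity matrix, and let $$\mathbf{M}=\begin{bmatrix}\tilde{\mathbf{A}} & 0\\ \mathbf{C} & \mathbf{I}\end{bmatrix}\in\mathbb{R}^{N\times N}.$$ Then the condition number of $\mathbf{M}$ in the $\infty$-norm satisfies $$\kappa_\infty(\mathbf{M})\le \kappa_\infty(\tilde{\mathbf{A}})\,\max\left(1,\frac{1+\|\mathbf{C}\|_\infty}{\|\tilde{\mathbf{A}}\|_\infty}\right)\max\left(1,\ \|\mathbf{C}\|_\infty+\frac{1}{\|\tilde{\mathbf{A}}^{-1}\|_\infty}\right).$$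
   Context: For vectors, $\|\cdot\|$ is the Euclidean norm on $\mathbb{R}^n$. For a real matrix $X$, $\|X\|_\infty=\max_i\sum_j|X_{ij}|$ is the operator norm induced by the vector $\infty$-norm, and for an invertible matrix $X$, $\kappa_\infty(X)=\|X\|_\infty\|X^{-1}\|_\infty$. The points $\mathbf{x}_1,\dots,\mathbf{x}_p$ are the data points detected as lying in smooth zones, and $\mathbf{x}_{p+1},\dots,\mathbf{x}_N$ are the data points at which the smoothness indicator is large (reordered to be last), whose kernel columns in the interpolation matrix have been replaced by columns of the identity. *)

(* Defs.v *)
From HB Require Import structures.
From mathcomp Require Import all_boot all_order all_algebra.
From mathcomp Require Import reals.

Set Implicit Arguments.
Unset Strict Implicit.
Unset Printing Implicit Defensive.

Import Order.TTheory GRing.Theory Num.Theory.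

Local Open Scope ring_scope.

Definition enorm (R : realType) (n : nat) (v : 'cV[R]_n) : R :=
  Num.sqrt (\sum_(i < n) v i 0 ^+ 2).

(* The row sums are nonnegative, so starting the maximum at 0 only matters for
   a matrix without rows, whose norm is 0. *)
Definition norm_inf (R : realType) (m n : nat) (X : 'M[R]_(m, n)) : R :=
  \big[Num.max/0]_(i < m) \sum_(j < n) `|X i j|.

(* Meaningful only for X \in unitmx: otherwise invmx X is X. *)
Definition cond_inf (R : realType) (n : nat) (X : 'M[R]_n) : R :=
  norm_inf X * norm_inf (invmx X).

Definition posdef_mx (R : realType) (n : nat) (X : 'M[R]_n) : Prop :=
  forall v : 'cV[R]_n, v != 0 -> 0 < (v^T *m X *m v) 0 0.

Definition interp_mx (R : realType) (n m k : nat) (phi : R -> R) (eps : R)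
    (y : 'I_m -> 'cV[R]_n) (z : 'I_k -> 'cV[R]_n) : 'M[R]_(m, k) :=
  \matrix_(i < m, j < k) phi (eps * enorm (y i - z j)).

(* The 0-based indices 0, ..., p - 1 and p, ..., N - 1 of 'I_N. *)
Definition first_idx (p N : nat) (le_pN : (p <= N)%N) (i : 'I_p) : 'I_N :=
  widen_ord le_pN i.

Definition last_idx (p N : nat) (le_pN : (p <= N)%N) (i : 'I_(N - p)) : 'I_N :=
  cast_ord (subnKC le_pN) (rshift p i).

(* The cast identifies p + (N - p) with N. *)
Definition block_mx_of_le (R : realType) (p N : nat) (le_pN : (p <= N)%N)
    (Aul : 'M[R]_p) (Aur : 'M[R]_(p, N - p))
    (Adl : 'M[R]_(N - p, p)) (Adr : 'M[R]_(N - p)) : 'M[R]_N :=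
  castmx (subnKC le_pN, subnKC le_pN) (block_mx Aul Aur Adl Adr).

(* Main.v *)
(* Since M is block lower triangular, its inverse is
   [A^-1, 0; - C A^-1, I].  Bounding the row sums of the two blocks of rows gives
     |M| <= max (|A|, 1 + |C|)  and  |M^-1| <= max (|A^-1|, 1 + |C| |A^-1|),
   and factoring |A| and |A^-1| out of these maxima gives the bound. *)

Require Import Defs.
From HB Require Import structures.
From mathcomp Require Import all_boot all_order all_algebra.
From mathcomp Require Import reals.

Set Implicit Arguments.
Unset Strict Implicit.
Unset Printing Implicit Defensive.

Import Order.TTheory GRing.Theory Num.Theory.

Local Open Scope ring_scope.

Section NormInf.
Variable R : realType.

Lemma norm_inf_ge0 m n (X : 'M[R]_(m, n)) : 0 <= norm_inf X.
Proof. exact: bigmax_ge_id. Qed.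

Lemma row_sum_le_norm_inf m n (X : 'M[R]_(m, n)) i :
  \sum_j `|X i j| <= norm_inf X.
Proof. exact: (le_bigmax 0 (fun i => \sum_j `|X i j|)). Qed.

Lemma norm_inf_le m n (X : 'M[R]_(m, n)) (c : R) :
  0 <= c -> (forall i, \sum_j `|X i j| <= c) -> norm_inf X <= c.
Proof. by move=> c_ge0 Xc; apply: bigmax_le. Qed.

(** Every entry is bounded in absolute value by its row sum, so a norm at most 0 forces all entries
    to vanish. This later justifies dividing by the norms of [A] and [invmx A]. *)
Lemma norm_inf_gt0 m n (X : 'M[R]_(m, n)) : X != 0 -> 0 < norm_inf X.
Proof.
apply: contraNT; rewrite -leNgt => X_le0.
apply/eqP/matrixP => i j; rewrite mxE; apply/eqP; rewrite -normr_le0.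
apply: le_trans X_le0; apply: le_trans (row_sum_le_norm_inf X i).
by rewrite (bigD1 j) //= lerDl sumr_ge0.
Qed.

Lemma norm_infN m n (X : 'M[R]_(m, n)) : norm_inf (- X) = norm_inf X.
Proof.
by apply: eq_bigr => i _; apply: eq_bigr => j _; rewrite mxE normrN.
Qed.

Lemma norm_inf0 m n : norm_inf (0 : 'M[R]_(m, n)) = 0.
Proof.
apply/eqP; rewrite eq_le norm_inf_ge0 andbT norm_inf_le // => i.
by rewrite big1 // => j _; rewrite mxE normr0.
Qed.

(** Only an inequality, since the norm is 0 when [n] is 0. *)
Lemma norm_inf1_le n : norm_inf (1%:M : 'M[R]_n) <= 1.
Proof.
apply: norm_inf_le => // i; rewrite (bigD1 i) //= big1 => [|j j_neq_i].
  by rewrite mxE eqxx normr1 addr0.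
by rewrite mxE eq_sym (negbTE j_neq_i) normr0.
Qed.

(** By the triangle inequality and an exchange of sums, a row sum of the product is at most a
    combination of row sums of [Y] weighted by the [|X i k|]. *)
Lemma norm_infM m n q (X : 'M[R]_(m, n)) (Y : 'M[R]_(n, q)) :
  norm_inf (X *m Y) <= norm_inf X * norm_inf Y.
Proof.
apply: norm_inf_le => [|i]; first by rewrite mulr_ge0 ?norm_inf_ge0.
apply: (@le_trans _ _ (\sum_j \sum_k `|X i k| * `|Y k j|)).
  apply: ler_sum => j _; rewrite mxE; apply: le_trans (ler_norm_sum _ _ _) _.
  by apply: ler_sum => k _; rewrite normrM.
rewrite exchange_big /=.
apply: (@le_trans _ _ (\sum_k `|X i k| * norm_inf Y)).
  by apply: ler_sum => k _; rewrite -mulr_sumr ler_wpM2l ?row_sum_le_norm_inf.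
by rewrite -mulr_suml ler_wpM2r ?norm_inf_ge0 ?row_sum_le_norm_inf.
Qed.

Lemma norm_inf_block_le m1 m2 n1 n2 (X : 'M[R]_(m1, n1)) (Y : 'M[R]_(m1, n2))
    (Z : 'M[R]_(m2, n1)) (W : 'M[R]_(m2, n2)) :
  norm_inf (block_mx X Y Z W) <=
    Num.max (norm_inf X + norm_inf Y) (norm_inf Z + norm_inf W).
Proof.
apply: norm_inf_le => [|i]; first by rewrite le_max addr_ge0 ?norm_inf_ge0.
rewrite big_split_ord /= le_max; case: (split_ordP i) => k ->.
  under eq_bigr do rewrite block_mxEul.
  under [X in _ + X]eq_bigr do rewrite block_mxEur.
  by rewrite lerD ?row_sum_le_norm_inf.
under eq_bigr do rewrite block_mxEdl.
under [X in _ + X]eq_bigr do rewrite block_mxEdr.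
by rewrite [X in _ || X]lerD ?row_sum_le_norm_inf ?orbT.
Qed.

Lemma cond_inf_castmx m n (eq_mn : m = n) (X : 'M[R]_m) :
  cond_inf (castmx (eq_mn, eq_mn) X) = cond_inf X.
Proof. by case: n / eq_mn; rewrite castmx_id. Qed.

Lemma unitmx_castmx m n (eq_mn : m = n) (X : 'M[R]_m) :
  (castmx (eq_mn, eq_mn) X \in unitmx) = (X \in unitmx).
Proof. by case: n / eq_mn; rewrite castmx_id. Qed.

(** A nonzero row vector [v] with [v *m X = 0] would make the quadratic form vanish at [v^T]. *)
Lemma posdef_mx_unit n (X : 'M[R]_n) : posdef_mx X -> X \in unitmx.
Proof.
move=> posX; rewrite -row_free_unit; apply: inj_row_free => v vX0.
apply/eqP; apply: contraT => v_neq0.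
have /posX : v^T != 0 by rewrite trmx_eq0.
by rewrite trmxK vX0 mul0mx mxE ltxx.
Qed.

Lemma mulmx_block_lower_unitri p q (A : 'M[R]_p) (C : 'M[R]_(q, p)) :
  A \in unitmx ->
  block_mx A 0 C 1%:M *m block_mx (invmx A) 0 (- (C *m invmx A)) 1%:M = 1%:M.
Proof.
move=> unitA; rewrite mulmx_block !mulmx0 !mul0mx !mul1mx.
by rewrite mulmxV // subrr !addr0 add0r -scalar_mx_block.
Qed.

Lemma cond_inf_block_lower p q (A : 'M[R]_p) (C : 'M[R]_(q, p)) :
  (0 < p)%N -> A \in unitmx ->
  block_mx A 0 C 1%:M \in unitmx /\
  cond_inf (block_mx A 0 C 1%:M) <=
    cond_inf A
    * Num.max 1 ((1 + norm_inf C) / norm_inf A)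
    * Num.max 1 (norm_inf C + (norm_inf (invmx A))^-1).
Proof.
move=> p_gt0 unitA; have MV1 := mulmx_block_lower_unitri C unitA.
have [unitM _] := mulmx1_unit MV1; split=> //.
have unit_neq0 (B : 'M[R]_p) : B \in unitmx -> B != 0.
  (* The zero matrix has rank 0, which differs from [p] because [p] is positive. *)
  by apply: contraTneq => ->; rewrite -row_free_unit /row_free mxrank0 eq_sym -lt0n.
have a_gt0 := norm_inf_gt0 (unit_neq0 _ unitA).
have b_gt0 : 0 < norm_inf (invmx A).
  by rewrite norm_inf_gt0 ?unit_neq0 ?unitmx_inv.
have invM : invmx (block_mx A 0 C 1%:M) =
            block_mx (invmx A) 0 (- (C *m invmx A)) 1%:M.
  (* Multiply the right inverse identity [MV1] on the left by the inverse. *)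
  by rewrite -[LHS]mulmx1 -MV1 mulKmx.
(* Pair the first maximum with the norm of [A] and the second with that of [invmx A], so that the
   two factors are bounded separately. *)
rewrite /cond_inf invM -[leRHS]mulrA mulrACA.
apply: ler_pM; rewrite ?norm_inf_ge0 //.
  apply: le_trans (norm_inf_block_le _ _ _ _) _.
  (* With a = |A| and c = |C|, a * max(1, (1 + c) / a) = max(a, 1 + c). *)
  rewrite (maxr_pMr _ _ (ltW a_gt0)) mulr1 mulrCA divff ?gt_eqF // mulr1.
  rewrite norm_inf0 addr0 addrC ge_max !le_max lexx /=.
  by rewrite lerD2r norm_inf1_le orbT.
apply: le_trans (norm_inf_block_le _ _ _ _) _.
(* With b = |A^-1|, b * max(1, c + 1 / b) = max(b, b c + 1). *)
rewrite (maxr_pMr _ _ (ltW b_gt0)) mulr1 mulrDr divff ?gt_eqF //.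
rewrite norm_inf0 addr0 norm_infN ge_max !le_max lexx /=.
by rewrite [X in _ || X]lerD ?norm_inf1_le ?orbT // mulrC norm_infM.
Qed.

End NormInf.

Theorem lemma4p1 (R : realType) (n N p : nat)
    (p_ge1 : (1 <= p)%N) (lt_pN : (p < N)%N)
    (x : 'I_N -> 'cV[R]_n) (eps : R) (eps_gt0 : 0 < eps) (phi : R -> R) :
  let le_pN : (p <= N)%N := ltnW lt_pN in
  let xs : 'I_p -> 'cV[R]_n := fun i => x (first_idx le_pN i) in
  let xd : 'I_(N - p) -> 'cV[R]_n := fun i => x (last_idx le_pN i) in
  let A : 'M[R]_p := interp_mx phi eps xs xs in
  let C : 'M[R]_(N - p, p) := interp_mx phi eps xd xs in
  let M : 'M[R]_N := block_mx_of_le le_pN A 0 C 1%:M in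
  A \is symmetricmx -> posdef_mx A ->
  M \in unitmx /\
  cond_inf M <=
    cond_inf A
    * Num.max 1 ((1 + norm_inf C) / norm_inf A)
    * Num.max 1 (norm_inf C + (norm_inf (invmx A))^-1).
Proof.
move=> le_pN xs xd A C M _ /posdef_mx_unit unitA.
rewrite /M /block_mx_of_le unitmx_castmx cond_inf_castmx.
exact: cond_inf_block_lower.
Qed.
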